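(* Let $A$ be an abelian group and $G=\operatorname{Aut}(A)$, acting on $A$ by the natural action. Let $q\in\mathbb{Z}$ be such that $q\,\mathrm{Id}_A:A\to A$ is an automorphism. Then $(q-1)$ annihilates $H^1(G,A)$ (cohomology for the natural action). As a consequence, let $p$ be a prime, let $\underline{\lambda}=(\lambda_1^{\rho_1}>\lambda_2^{\rho_2}>\cdots>\lambda_k^{\rho_k})$ be a partition, let $\mathcal{A}_{\underline{\lambda}}=\bigoplus_{i=1}^k(\mathbb{Z}/p^{\lambda_i}\mathbb{Z})^{\rho_i}$ and $\mathcal{G}_{\underline{\lambda}}=\operatorname{Aut}(\mathcal{A}_{\underline{\lambda}})$ acting naturally on $\mathcal{A}_{\underline{\lambda}}$. Then: (a) if $p\neq 2$, then $H^1(\mathcal{G}_{\underline{\lambda}},\mathcal{A}_{\underline{\lambda}})=0$; (b) if $p=2$, then $H^1(\mathcal{G}_{\underline{\lambda}},\mathcal{A}_{\underline{\lambda}})$ is a finite elementary abelian $2$-group.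
   Context: The natural action of $\operatorname{Aut}(A)$ on $A$ is $g\cdot a=g(a)$. A partition $\underline{\lambda}=(\lambda_1^{\rho_1}>\cdots>\lambda_k^{\rho_k})$ consists of positive integers $\lambda_1>\lambda_2>\cdots>\lambda_k$ (the distinct parts) with positive integer multiplicities $\rho_1,\dots,\rho_k$, $k\geq 1$. $H^i(G,A)$ denotes ordinary group cohomology. *)

(* Defs.v *)
From HB Require Import structures.
From mathcomp Require Import all_boot all_order all_algebra.
From mathcomp Require Import boolp classical_sets functions cardinality.

Set Implicit Arguments.
Unset Strict Implicit.
Unset Printing Implicit Defensive.

Import GRing.Theory.
Local Open Scope ring_scope.

Section Automorphisms.
Variable A : zmodType.

Definition is_automorphism (f : A -> A) : Prop :=
  {morph f : x y / x + y} /\ bijective f.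

Record autom := Autom {
  autom_fun :> A -> A;
  _ : `[< is_automorphism autom_fun >]
}.

HB.instance Definition _ := [isSub for autom_fun].
HB.instance Definition _ := [Choice of autom by <:].

Implicit Types f g h : autom.

Lemma automP f : is_automorphism f.
Proof. by case: f => f /= /asboolP. Qed.

Lemma eq_autom f g : (forall x, f x = g x) -> f = g.
Proof. by move=> fg; apply: val_inj; apply/funext. Qed.

Definition mk_autom (f : A -> A) (fA : is_automorphism f) : autom :=
  Autom (introT (asboolP _) fA).

Fact autom1_subproof : is_automorphism id.
Proof. by split=> //; exists id. Qed.
Definition autom1 : autom := mk_autom autom1_subproof.

Fact automM_subproof f g : is_automorphism (f \o g).
Proof.
have [fD fB] := automP f; have [gD gB] := automP g.
by split=> [x y|] /=; [rewrite gD fD | exact: bij_comp].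
Qed.
Definition automM f g : autom := mk_autom (automM_subproof f g).

Fact automV_subproof f : exists g : autom, cancel f g /\ cancel g f.
Proof.
have [fD [g fK gK]] := automP f.
have gA : is_automorphism g.
  by split; [move=> x y; rewrite -{1}[x]gK -{1}[y]gK -fD fK | exists f].
by exists (mk_autom gA).
Qed.
Definition automV f : autom := sval (cid (automV_subproof f)).

Fact automMA : associative automM. Proof. by move=> *; apply: eq_autom. Qed.
Fact autom1M : left_id autom1 automM. Proof. by move=> *; apply: eq_autom. Qed.
Fact automM1 : right_id autom1 automM. Proof. by move=> *; apply: eq_autom. Qed.
Fact automVM : left_inverse autom1 automV automM.
Proof.
by move=> f; apply: eq_autom; exact: (svalP (cid (automV_subproof f))).1.
Qed.
Fact automMV : right_inverse autom1 automV automM.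
Proof.
by move=> f; apply: eq_autom; exact: (svalP (cid (automV_subproof f))).2.
Qed.

HB.instance Definition _ :=
  isGroup.Build autom automMA autom1M automM1 automVM automMV.

End Automorphisms.

Record gmodule (G : groupType) (A : zmodType) := GModule {
  gact :> G -> A -> A;
  gact1 : forall a, gact 1%g a = a;
  gactM : forall g h a, gact (g * h)%g a = gact g (gact h a);
  gactD : forall g, {morph gact g : a b / a + b}
}.

Definition natural_action (A : zmodType) : gmodule (autom A) A :=
  @GModule (autom A) A (fun g a => g a) (fun=> erefl) (fun _ _ _ => erefl)
    (fun g => (automP g).1).

(* Group cohomology, computed by the inhomogeneous (bar) cochain complex. *)
Section Cohomology.
Variables (G : groupType) (A : zmodType) (M : gmodule G A).

Definition cochain (n : nat) : Type := ('I_n -> G) -> A.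
HB.instance Definition _ n := GRing.Zmodule.on (cochain n).

(* For (g_0, .., g_n), the tuple (g_0, .., g_i * g_(i+1), .., g_n). *)
Definition merge_at n (g : 'I_n.+1 -> G) (i : 'I_n) : 'I_n -> G :=
  fun j => if (j < i)%N then g (widen_ord (leqnSn n) j)
           else if j == i then (g (widen_ord (leqnSn n) j) * g (lift ord0 j))%g
           else g (lift ord0 j).

Definition differential n (f : cochain n) : cochain n.+1 := fun g =>
  M (g ord0) (f (fun j => g (lift ord0 j)))
  + \sum_(i < n) f (merge_at g i) *~ (-1) ^+ i.+1
  + f (fun j => g (widen_ord (leqnSn n) j)) *~ (-1) ^+ n.+1.

Fact differential_is_zmod_morphism n : zmod_morphism (@differential n).
Proof.
have MB x : {morph M x : a b / a - b}.
  by move=> a b; apply: (addIr (M x b)); rewrite -gactD !subrK.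
move=> f h; apply/funext => g.
have subE m (u v : cochain m) x : (u - v) x = u x - v x by [].
rewrite subE /differential !subE MB mulrzBl.
under eq_bigr do rewrite subE mulrzBl.
by rewrite sumrB !opprD (addrACA (M _ _)) (addrACA (M _ _ + _)).
Qed.
HB.instance Definition _ n := GRing.isZmodMorphism.Build
  (cochain n) (cochain n.+1) (@differential n) (@differential_is_zmod_morphism n).

Definition is_cocycle n : {pred cochain n} := fun f => differential f == 0.

Fact is_cocycle_zmod_closed n : zmod_closed (@is_cocycle n).
Proof.
split=> [|f h]; rewrite !unfold_in ?raddf0 // => /eqP df /eqP dh.
by rewrite raddfB /= df dh subrr.
Qed.
HB.instance Definition _ n :=
  GRing.isZmodClosed.Build (cochain n) (@is_cocycle n) (@is_cocycle_zmod_closed n).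

Record cocycle n := Cocycle {
  cocycle_val :> cochain n;
  _ : cocycle_val \in @is_cocycle n
}.
HB.instance Definition _ n := [isSub for @cocycle_val n].
HB.instance Definition _ n := [Choice of cocycle n by <:].
HB.instance Definition _ n := [SubChoice_isSubZmodule of cocycle n by <:].

Definition coboundary n : cochain n -> Prop :=
  match n with
  | 0 => fun f => f = 0
  | m.+1 => fun f => exists h : cochain m, f = differential h
  end.

(* As a predicate on cocycles, so that the quotient below is ker d / im d. *)
Definition is_coboundary n : {pred cocycle n} :=
  fun f => `[< coboundary (cocycle_val f) >].

Fact is_coboundary_zmod_closed n : zmod_closed (@is_coboundary n).
Proof.
split=> [|f h]; rewrite !unfold_in.
  by apply/asboolP; case: n => [|n] //=; exists 0; rewrite raddf0.
move=> /asboolP Bf /asboolP Bh; apply/asboolP.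
case: n f h Bf Bh => [|n] f h /=; first by move=> -> ->; rewrite subrr.
by move=> [u ->] [v ->]; exists (u - v); rewrite raddfB.
Qed.
HB.instance Definition _ n :=
  GRing.isZmodClosed.Build (cocycle n) (@is_coboundary n)
    (@is_coboundary_zmod_closed n).

Definition cohomology n : zmodType := {ideal_quot @is_coboundary n}.

End Cohomology.

Record int_partition := IntPartition {
  npart : nat;
  part : 'I_npart -> nat;
  mult : 'I_npart -> nat;
  npart_gt0 : (0 < npart)%N;
  part_decr : forall i j : 'I_npart, (i < j)%N -> (part j < part i)%N;
  part_gt0 : forall i, (0 < part i)%N;
  mult_gt0 : forall i, (0 < mult i)%N
}.

Definition elementary_abelian (p : nat) (V : zmodType) : Prop :=
  forall x : V, x *+ p = 0.

Section AbelianPGroup.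
Variables (p : nat) (lam : int_partition).

(* 'Z_n is the ring Z/nZ only for n > 1: here p is meant to be prime, and then
   p ^ part i > 1 by part_gt0. *)
Definition abelian_p_group : Type :=
  {dffun forall i : 'I_(npart lam), 'rV['Z_(p ^ part i)]_(mult i)}.
HB.instance Definition _ := Finite.on abelian_p_group.

Implicit Types x y z : abelian_p_group.
Let zero : abelian_p_group := [ffun=> 0].
Let opp x : abelian_p_group := [ffun i => - x i].
Let add x y : abelian_p_group := [ffun i => x i + y i].

Fact abelian_p_group_addA : associative add.
Proof. by move=> x y z; apply/ffunP => i; rewrite !ffunE addrA. Qed.
Fact abelian_p_group_addC : commutative add.
Proof. by move=> x y; apply/ffunP => i; rewrite !ffunE addrC. Qed.
Fact abelian_p_group_add0 : left_id zero add.
Proof. by move=> x; apply/ffunP => i; rewrite !ffunE add0r. Qed.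
Fact abelian_p_group_addN : left_inverse zero opp add.
Proof. by move=> x; apply/ffunP => i; rewrite !ffunE addNr. Qed.

HB.instance Definition _ := GRing.isZmodule.Build abelian_p_group
  abelian_p_group_addA abelian_p_group_addC abelian_p_group_add0
  abelian_p_group_addN.

End AbelianPGroup.

(* Main.v *)
(** Multiplication by [q] is a central element [c] of [Aut A].  For a 1-cocycle
    [f], expanding [f (c g) = f (g c)] both ways gives
    [(q - 1) f g = g (f c) - f c], which is the coboundary of [f c].
    For the finite [p]-group take [q = 2] when [p] is odd and [q = 3] when
    [p = 2]. *)
From HB Require Import structures.
Require Import Defs.
From mathcomp Require Import all_boot all_order all_algebra.
From mathcomp Require Import boolp classical_sets functions cardinality.

Set Implicit Arguments.
Unset Strict Implicit.
Unset Printing Implicit Defensive.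

Import GRing.Theory.
Local Open Scope ring_scope.

Section FirstCohomology.
Variables (G : groupType) (A : zmodType) (M : gmodule G A).

Lemma cocycle1M (f : cochain G A 1) (g h : G) : f \in @is_cocycle _ _ M 1 ->
  f (fun=> (g * h)%g) = M g (f (fun=> h)) + f (fun=> g).
Proof.
rewrite unfold_in => /eqP.
(* Evaluate [differential f = 0] at the pair [(g, h)]: the faces are [h], [g * h] and [g], with
   signs [+], [-], [+]. *)
move/(congr1 (fun u => u (fun i : 'I_2 => if i == ord0 then g else h))).
rewrite /differential big_ord1 /= expr1 expr2 mulrNN mulr1 mulr1z mulrN1z.
have -> : (fun j : 'I_1 => if widen_ord (leqnSn 1) j == ord0 then g else h)
          = fun=> g.
  by apply/funext => j; rewrite (ord1 j).
have -> : merge_at (fun i : 'I_2 => if i == ord0 then g else h) ord0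
          = fun=> (g * h)%g.
  by apply/funext => j; rewrite (ord1 j).
by rewrite addrAC => /eqP; rewrite subr_eq add0r => /eqP <-.
Qed.

Lemma coboundary1P (f : cochain G A 1) :
  coboundary M f <-> exists a, forall g, f (fun=> g) = M g a - a.
Proof.
have diff0 (u : cochain G A 0) (g : 'I_1 -> G) :
    differential M u g = M (g ord0) (u (fun=> 1%g)) - u (fun=> 1%g).
  rewrite /differential big_ord0 addr0 expr1 mulrN1z.
  (* There is exactly one map ['I_0 -> G], so [fun=> 1%g] stands for the empty tuple and a 0-cochain
     is a single element of [A]. *)
  by congr (M _ (u _) - u _); apply/funext => -[].
split=> [[u ->]|[a fE]]; first by exists (u (fun=> 1%g)) => g; rewrite diff0.
exists (fun=> a); apply/funext => g; rewrite diff0 -fE.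
by congr f; apply/funext => j; rewrite (ord1 j).
Qed.

(** For the natural action this is the centrality of multiplication by an integer among the
    automorphisms. *)
Lemma gactMz (g : G) (n : int) (a : A) : M g (a *~ n) = M g a *~ n.
Proof.
have MB : zmod_morphism (M g).
  by move=> x y; apply: (addIr (M g y)); rewrite -gactD !subrK.
pose f : {additive A -> A} :=
  HB.pack (gact M g) (GRing.isZmodMorphism.Build A A (gact M g) MB).
exact: (raddfMz f).
Qed.

Lemma cocycle_evalMz n (f : cocycle M n) (m : int) (g : 'I_n -> G) :
  cocycle_val (f *~ m) g = cocycle_val f g *~ m.
Proof.
pose eval (h : cocycle M n) := cocycle_val h g.
have evalB : zmod_morphism eval by [].
pose ev : {additive cocycle M n -> A} :=
  HB.pack eval (GRing.isZmodMorphism.Build (cocycle M n) A eval evalB).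
exact: (raddfMz ev).
Qed.

Lemma cohomology_pi_surj n (x : cohomology M n) :
  exists f : cocycle M n, \pi_(cohomology M n)%qT f = x.
Proof. by exists (repr x); rewrite reprK. Qed.

Lemma cohomology_pi0 n (f : cocycle M n) :
  coboundary M (cocycle_val f) -> \pi_(cohomology M n)%qT f = 0.
Proof.
move=> fB; apply/eqP; rewrite -(raddf0 (\pi_(cohomology M n)%qT)).
rewrite -Quotient.idealrBE subr0 unfold_in; exact/asboolP.
Qed.

End FirstCohomology.

Lemma cohomology1_annihilated (A : zmodType) (q : int) :
  is_automorphism (fun a : A => a *~ q) ->
  forall x : cohomology (natural_action A) 1, x *~ (q - 1) = 0.
Proof.
move=> qA x; have [f <-] := cohomology_pi_surj x.
rewrite -raddfMz; apply: cohomology_pi0; apply/coboundary1P.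
pose c := mk_autom qA; exists (cocycle_val f (fun=> c)) => g.
have cg : (c * g)%g = (g * c)%g.
  by apply: eq_autom => a; exact: esym (gactMz (natural_action A) g q a).
have := cocycle1M c g (valP f).
rewrite cg (cocycle1M _ _ (valP f)) /= cocycle_evalMz mulrzBr mulr1z.
by move/eqP; rewrite -subr_eq => /eqP <-; rewrite addrAC addrK.
Qed.

(** By Bezout, [u * m + v * q = 1]; since [m] kills [A], multiplication by [v] inverts
    multiplication by [q]. *)
Lemma mulrz_automorphism (A : zmodType) (m : nat) (q : int) :
  (forall a : A, a *+ m = 0) -> coprimez m q ->
  is_automorphism (fun a : A => a *~ q).
Proof.
move=> mA /coprimezP[[u v] /= uv]; split=> [a b|]; first exact: mulrzDl.
have vq (a : A) : a *~ (v * q) = a.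
  by rewrite -[RHS]mulr1z -uv mulrzDr (mulrC u) (mulrzA a m) -pmulrn mA mul0rz
             add0r.
by exists (fun a => a *~ v) => a; rewrite -mulrzA // mulrC.
Qed.

(** Any power of [p] killing the group suffices for the coprimality with [q]; the sum of the parts
    avoids singling out the largest one. *)
Lemma abelian_p_group_exponent (p : nat) (lam : int_partition) :
  prime p ->
  forall x : abelian_p_group p lam, x *+ p ^ (\sum_(i < npart lam) part i) = 0.
Proof.
move=> p_pr x; apply/ffunP => i.
have mulrnE n : (x *+ n) i = x i *+ n.
  by elim: n => [|n IHn]; rewrite ?mulr0n ?ffunE // !mulrS ffunE IHn.
rewrite mulrnE ffunE (bigD1 i) //= expnD mulrnA; apply/matrixP => j k.
(* ['Z_n] has characteristic [n] only for [1 < n]. *)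
have gt1 : (1 < p ^ part i)%N.
  by rewrite -[1%N](exp1n (part i)) ltn_exp2r;
    [exact: prime_gt1 | exact: Defs.part_gt0].
by rewrite !mulmxnE -[X in X *+ _]mulr_natr pchar_Zp // mulr0 mul0rn mxE.
Qed.

Lemma finite_set_inj (T : Type) (U : finType) (f : T -> U) :
  injective f -> finite_set [set: T].
Proof.
move=> f_inj; rewrite -(preimage_setT f); apply: finite_preimage.
  by move=> x y _ _; exact: f_inj.
exact: finite_finset.
Qed.

(** The injection [e] expresses that [G] is finite. A cocycle is then determined by a finite table
    of values, and cohomology is the image of the cocycles under the quotient map. *)
Lemma finite_cohomology (G : groupType) (A : finZmodType) (M : gmodule G A)
    (T : finType) (e : G -> T) (n : nat) :
  injective e -> finite_set [set: cohomology M n].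
Proof.
move=> e_inj.
pose tab (g : 'I_n -> G) := [ffun i => e (g i)].
have tab_inj : injective tab.
  move=> g h /ffunP gh; apply/funext => i.
  by have := gh i; rewrite !ffunE => /e_inj.
(* A left inverse of [tab]; the default tuple occurs only off the image of [tab], where injectivity
   of [code] needs no information. *)
pose untab t := xget (fun=> 1%g) [set g | tab g = t].
have tabK g : untab (tab g) = g.
  by rewrite /untab; case: xgetP => [h _ /tab_inj|/(_ g) []].
pose code (f : cocycle M n) := [ffun t => cocycle_val f (untab t)].
have code_inj : injective code.
  move=> f h /ffunP fh; apply/val_inj/funext => g.
  by have := fh (tab g); rewrite !ffunE tabK.
have /(finite_image (\pi_(cohomology M n)%qT)) := finite_set_inj code_inj.
apply: sub_finite_set => x _.
by have [f <-] := cohomology_pi_surj x; exists f.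
Qed.

Lemma finite_cohomology_natural_action (A : finZmodType) (n : nat) :
  finite_set [set: cohomology (natural_action A) n].
Proof.
apply: (@finite_cohomology _ A _ _ (fun g : autom A => [ffun a => g a])).
move=> g h /ffunP gh; apply: eq_autom => a.
by have := gh a; rewrite !ffunE.
Qed.

Theorem theorem3p1 :
  (forall (A : zmodType) (q : int),
     is_automorphism (fun a : A => a *~ q) ->
     forall x : cohomology (natural_action A) 1, x *~ (q - 1) = 0)
  /\
  (forall (p : nat) (lam : int_partition), prime p ->
     let H1 := cohomology (natural_action (abelian_p_group p lam)) 1 in
     (p <> 2%N -> forall x : H1, x = 0)
     /\
     (p = 2%N -> finite_set [set: H1]%classic /\ elementary_abelian 2 H1)).
Proof.
split=> [|p lam p_pr H1]; first exact: cohomology1_annihilated.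
have pA := abelian_p_group_exponent (lam := lam) p_pr.
split=> [/eqP p2 x|p2].
  (* For [q = 2] the annihilator [q - 1] computes to [1], so annihilation is vanishing. *)
  rewrite -[x]mulr1z; apply: (cohomology1_annihilated (q := 2)).
  apply: mulrz_automorphism pA _.
  by rewrite coprimezE !absz_nat coprimeXl // prime_coprime // dvdn_prime2.
split; first exact: finite_cohomology_natural_action.
(* Here [q - 1] computes to [2], and 3 is coprime to every power of 2. *)
move=> x; rewrite pmulrn; apply: (cohomology1_annihilated (q := 3)).
apply: mulrz_automorphism pA _.
by rewrite coprimezE !absz_nat coprimeXl // p2.
Qed.
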